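(* Let $\mathbf P=(P,\le,{}',0,1)$ be a strong skew orthomodular poset and $a,b\in P$. Then the following are equivalent: (i) $a\mathrel{\mathrm C}b$; (ii) $b\mathrel{\mathrm C}a$; (iii) $c(a,b)=1$.
   Context: An orthoposet is a bounded poset $(P,\le,{}',0,1)$ with an antitone involution ${}'$ (i.e. $x\le y$ implies $y'\le x'$, and $x''=x$) that is a complementation (i.e. $x\vee x'=1$ and $x\wedge x'=0$ for all $x$). For $A\subseteq P$: $L(A):=\{x\in P\mid x\le y\text{ for all }y\in A\}$, $U(A):=\{x\in P\mid y\le x\text{ for all }y\in A\}$, $A':=\{x'\mid x\in A\}$. When several arguments (elements and/or subsets) are listed inside $L$ or $U$, the operator is applied to the union of these sets, elements being read as singletons. Singletons are identified with their unique element (so $c(a,b)=1$ means $c(a,b)=\{1\}$). For $A\subseteq P$ and $y\in P$, $A\le y$ means $x\le y$ for all $x\in A$, and $y\le A$ means $y\le x$ for all $x\in A$. A strong skew orthomodular poset is an orthoposet such that for all $A\subseteq P$ and $y\in P$: $A\le y$ implies $U(y)=U\big(A,L(y,A')\big)$ (equivalently, for all $A\subseteq P$ and $x\in P$: $x\le A$ implies $L(x)=L\big(A,U(x,A')\big)$). For $x,y\in P$ define $c(x,y):=U\big(L(x,y),L(x,y'),L(x',y),L(x',y')\big)$, and $x\mathrel{\mathrm C}y$ if $U(x)=U\big(L(x,y),L(x,y')\big)$. *)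

(* Defs.v *)
From mathcomp Require Import all_boot all_order.
From mathcomp Require Import boolp classical_sets.

Set Implicit Arguments.
Unset Strict Implicit.
Unset Printing Implicit Defensive.

Local Open Scope classical_set_scope.

(* L(A) and U(A) are [lbound A] and [ubound A]; a list of arguments of L or U
   is the union of the corresponding sets, elements being singletons. *)

Record is_orthoposet (d : Order.disp_t) (P : tbPOrderType d)
    (compl : P -> P) : Prop := IsOrthoposet {
  compl_antitone : forall x y : P, (x <= y)%O -> (compl y <= compl x)%O ;
  compl_involutive : involutive compl ;
  compl_join : forall x : P, supremums [set x; compl x] \top%O ;
  compl_meet : forall x : P, infimums [set x; compl x] \bot%O
}.

Record is_strong_skew_orthomodular (d : Order.disp_t) (P : tbPOrderType d)
    (compl : P -> P) : Prop := IsStrongSkewOrthomodular {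
  strong_skew_orthoposet : is_orthoposet compl ;
  strong_skew_law : forall (A : set P) (y : P),
    (forall x, A x -> (x <= y)%O) ->
    ubound [set y] = ubound (A `|` lbound ([set y] `|` compl @` A))
}.

Definition commutator (d : Order.disp_t) (P : tbPOrderType d)
    (compl : P -> P) (x y : P) : set P :=
  ubound (lbound [set x; y] `|` lbound [set x; compl y]
          `|` lbound [set compl x; y] `|` lbound [set compl x; compl y]).

Definition commutes (d : Order.disp_t) (P : tbPOrderType d)
    (compl : P -> P) (x y : P) : Prop :=
  ubound [set x] = ubound (lbound [set x; y] `|` lbound [set x; compl y]).

(* Main.v *)
Require Import Defs.
From mathcomp Require Import all_boot all_order.
From mathcomp Require Import boolp classical_sets.

(** The relation x C y says that x is the least upper bound of the set
    L(x,y) together with L(x,y'), so it amounts to the single inequality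
    x <= u for every upper bound u of that set ([commutesP]).  Such
    inequalities come out of the strong skew law applied to a set A below x:
    whatever bounds both A and the relative complement L(x,A') also bounds x
    ([le_of_relative_compl]).

    Symmetry ([commutes_sym]) follows the classical argument for orthomodular
    lattices, with A = L(x,y) below y.  An element z of the relative complement
    L(y,A') has z' above L(x,y), and above L(x,y') because z <= y; hence
    x C y gives x <= z', so z lies in L(x',y).  Thus y is the supremum of
    L(y,x) and L(y,x').

    If a C b, then also a C b', and symmetry yields b C a and b' C a.
    Every element of c(a,b) is therefore above both b and b', that is, equal
    to 1 ([commutator_top]).

    Conversely, let c(a,b) = 1 and A be the union of L(a,b) and L(a,b').  For z
    in the relative complement L(a,A'), the element z' is above A, and above
    L(a',b) and L(a',b') because z <= a.  So z' is in c(a,b), which forces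
    z = 0: the relative complement is trivial, and a is the supremum of A
    ([commutes_of_commutator]). *)

Import Order.TTheory.

Local Open Scope classical_set_scope.

Section StrongSkewOrthomodular.

Set Implicit Arguments.
Unset Strict Implicit.

Context (d : Order.disp_t) (P : tbPOrderType d) (compl : P -> P).
Hypothesis hP : is_strong_skew_orthomodular compl.

Let complK : involutive compl :=
  compl_involutive (strong_skew_orthoposet hP).

Lemma le_compl_swap (x y : P) : (x <= compl y)%O -> (y <= compl x)%O.
Proof.
move=> xy; rewrite -[y]complK.
exact: (compl_antitone (strong_skew_orthoposet hP)).
Qed.

Lemma compl_topE (z : P) : compl z = \top%O -> z = \bot%O.
Proof.
move=> z1; apply/eqP; rewrite -lex0.
have [_] := compl_meet (strong_skew_orthoposet hP) z; apply.
by move=> w [->|->] //; rewrite z1 lex1.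
Qed.

Lemma le_compl_top (x u : P) : (x <= u)%O -> (compl x <= u)%O -> u = \top%O.
Proof.
move=> xu x'u; apply/eqP; rewrite -le1x.
have [_] := compl_join (strong_skew_orthoposet hP) x; apply.
by move=> w [->|->].
Qed.

Lemma lbound_set2P (x y z : P) :
  lbound [set x; y] z <-> (z <= x)%O /\ (z <= y)%O.
Proof.
split=> [zxy|[zx zy] w [->|->] //].
by split; apply: zxy; [left|right].
Qed.

(** The form in which the strong skew law is applied: membership in the
    relative complement L(y,A') is spelled as z <= y and A <= z', with the
    complementation moved from A to z. *)
Lemma le_of_relative_compl (A : set P) (y u : P) :
  (forall x, A x -> (x <= y)%O) ->
  (forall x, A x -> (x <= u)%O) ->
  (forall z, (z <= y)%O -> (forall x, A x -> (x <= compl z)%O) ->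
     (z <= u)%O) ->
  (y <= u)%O.
Proof.
move=> Ay Au zu.
suff : ubound [set y] u by apply.
rewrite (strong_skew_law hP Ay) => z [/Au //|zL].
apply: zu => [|x Ax]; first by apply: zL; left.
by apply: le_compl_swap; apply: zL; right; exists x.
Qed.

(** The reverse inclusion in the definition of x C y always holds, as L(x,y)
    and L(x,y') are below x. *)
Lemma commutesP (x y : P) :
  commutes compl x y <->
  forall u, (forall w, (w <= x)%O -> (w <= y)%O -> (w <= u)%O) ->
            (forall w, (w <= x)%O -> (w <= compl y)%O -> (w <= u)%O) ->
            (x <= u)%O.
Proof.
split=> [xCy u xyu xy'u|xle].
  suff : ubound [set x] u by apply.
  by rewrite xCy => w [] /lbound_set2P[]; [exact: xyu|exact: xy'u].
apply/seteqP; split=> u Uu.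
  move=> w ww; apply: (@le_trans _ _ x); last exact: Uu.
  by case: ww => /lbound_set2P[].
by move=> _ ->; apply: xle => w wx wy; apply: Uu; [left|right];
  apply/lbound_set2P.
Qed.

Lemma commutatorP (x y u : P) :
  commutator compl x y u <->
  [/\ forall w, (w <= x)%O -> (w <= y)%O -> (w <= u)%O,
      forall w, (w <= x)%O -> (w <= compl y)%O -> (w <= u)%O,
      forall w, (w <= compl x)%O -> (w <= y)%O -> (w <= u)%O &
      forall w, (w <= compl x)%O -> (w <= compl y)%O -> (w <= u)%O].
Proof.
split=> [cu|[xy xy' x'y x'y'] w].
  split=> w wx wy; apply: cu.
  - by left; left; left; apply/lbound_set2P.
  - by left; left; right; apply/lbound_set2P.
  - by left; right; apply/lbound_set2P.
  - by right; apply/lbound_set2P.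
case=> [[[|]|]|] /lbound_set2P[].
- exact: xy.
- exact: xy'.
- exact: x'y.
- exact: x'y'.
Qed.

Lemma commutes_compl_r (x y : P) :
  commutes compl x y -> commutes compl x (compl y).
Proof.
by move=> /commutesP xCy; apply/commutesP => u; rewrite complK => *; apply: xCy.
Qed.

(** As x <= z' means z <= x', the hypothesis x C y places the part of y that is
    orthogonal to L(x,y) inside L(y,x'). *)
Lemma commutes_sym (x y : P) : commutes compl x y -> commutes compl y x.
Proof.
move=> /commutesP xCy; apply/commutesP => u yxu yx'u.
apply: (@le_of_relative_compl (lbound [set x; y])) => [w|w|z zy zL].
- by case/lbound_set2P.
- by case/lbound_set2P => wx wy; apply: yxu.
apply: yx'u => //; apply: le_compl_swap; apply: xCy => w wx wy.
  by apply: zL; apply/lbound_set2P.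
apply: le_trans wy _.
exact: (compl_antitone (strong_skew_orthoposet hP)).
Qed.

Lemma commutator_sym (x y : P) : commutator compl x y = commutator compl y x.
Proof.
apply/seteqP; split=> u /commutatorP[c1 c2 c3 c4]; apply/commutatorP;
  by split=> *; [exact: c1|exact: c3|exact: c2|exact: c4].
Qed.

Lemma commutator_top (x y : P) :
  commutes compl x y -> commutator compl x y = [set \top%O].
Proof.
move=> xCy; apply/seteqP; split=> [u /commutatorP[c1 c2 c3 c4]|_ ->]; last first.
  by apply/commutatorP; split=> *; exact: lex1.
have /commutesP yCx := commutes_sym xCy.
have /commutesP y'Cx := commutes_sym (commutes_compl_r xCy).
apply: (@le_compl_top y).
  by apply: yCx => w wy wx; [exact: c1|exact: c3].
by apply: y'Cx => w wy wx; [exact: c2|exact: c4].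
Qed.

(** An element z of the relative complement of L(x,y) and L(x,y') in x is
    orthogonal to all four sets defining c(x,y), so z' = 1. *)
Lemma commutes_of_commutator (x y : P) :
  commutator compl x y = [set \top%O] -> commutes compl x y.
Proof.
move=> c1; apply/commutesP => u xyu xy'u.
apply: (@le_of_relative_compl (lbound [set x; y] `|` lbound [set x; compl y]))
  => [w|w|z zx zL].
- by case=> /lbound_set2P[].
- by case=> /lbound_set2P[]; [exact: xyu|exact: xy'u].
have x'z' : (compl x <= compl z)%O.
  exact: (compl_antitone (strong_skew_orthoposet hP)).
have : commutator compl x y (compl z).
  apply/commutatorP; split=> w wx wy.
  - by apply: zL; left; apply/lbound_set2P.
  - by apply: zL; right; apply/lbound_set2P.
  - exact: le_trans wx x'z'.
  - exact: le_trans wx x'z'.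
by rewrite c1 => /compl_topE ->; exact: le0x.
Qed.

End StrongSkewOrthomodular.

Theorem theorem4p4 (d : Order.disp_t) (P : tbPOrderType d) (compl : P -> P)
    (hP : is_strong_skew_orthomodular compl) (a b : P) :
  (commutes compl a b <-> commutes compl b a) /\
  (commutes compl b a <-> commutator compl a b = [set \top%O]).
Proof.
split; first by split; exact: commutes_sym.
rewrite commutator_sym.
by split; [exact: commutator_top|exact: commutes_of_commutator].
Qed.
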